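(* Let $d\ge 2$, let $\Omega\subset\mathbb{R}^d$ be a bounded polytopal domain, let $\mathcal{M}=(\mathcal{T},\mathcal{E})$ be a Voronoi tessellation over $\Omega$ with $N$ cells $T_1,\dots,T_N$ and corresponding centres $\vec{v}_1,\dots,\vec{v}_N\in\mathbb{R}^d$, and let $\vec{\omega}\in\mathbb{S}^{d-1}$. Then the Voronoi-Scheduler algorithm, given the input $(\{\vec{v}_i\}_{i=1}^N,\vec{\omega})$, outputs a topological sort of the directed dual mesh $\mathcal{M}^*_{\vec{\omega}}$. The algorithm has time complexity $\mathcal{O}(N\ln N+dN)$ and space complexity $\mathcal{O}(dN)$.
   Context: Voronoi-Scheduler algorithm. Input: Voronoi centres $\{\vec{v}_i\}_{i=1}^N\subset\mathbb{R}^d$ and a direction $\vec{\omega}\in\mathbb{S}^{d-1}$ (the unit sphere in $\mathbb{R}^d$). For each $i=1,\dots,N$ compute $\delta_i=\vec{\omega}\cdot\vec{v}_i$ and append it to a list. Return the ordering obtained by an argsort of the list $(\delta_1,\dots,\delta_N)$, i.e. a permutation $\pi$ of $\{1,\dots,N\}$ with $\delta_{\pi(1)}\le\delta_{\pi(2)}\le\dots\le\delta_{\pi(N)}$ (ties ordered arbitrarily). Complexity is counted with unit cost for arithmetic operations, comparisons and storage of real numbers, the argsort being carried out by a standard comparison sort using $\mathcal{O}(N\ln N)$ operations and $\mathcal{O}(N)$ space. Topological sort. A topological sort of a directed graph on vertices $T_1,\dots,T_N$ is an ordering $T_{\pi(1)},\dots,T_{\pi(N)}$ of all the vertices such that for every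 directed edge $(T_i,T_j)$ the vertex $T_i$ appears before $T_j$. Polytopal mesh. A polytopal mesh over $\Omega$ is a pair $(\mathcal{T},\mathcal{E})$ where: (1) the element set $\mathcal{T}$ is a (finite) subdivision of $\Omega$ into disjoint $d$-dimensional polytopes with $\overline{\Omega}=\bigcup_{T\in\mathcal{T}}\overline{T}$; (2) the facet set $\mathcal{E}$ is the set of all $(d-1)$-dimensional facets associated with the subdivision $\mathcal{T}$, including those on the boundary $\partial\Omega$; the elements of $\mathcal{E}$ form a partition of the mesh skeleton $\bigcup_{T\in\mathcal{T}}\partial T$. For $T\in\mathcal{T}$ put $\mathcal{E}_T:=\{F\in\mathcal{E} : F\subset\partial T\}$, and for $T_1,T_2\in\mathcal{T}$ put $\mathcal{E}_{T_1,T_2}:=\mathcal{E}_{T_1}\cap\mathcal{E}_{T_2}$, the set of facets shared by $T_1$ and $T_2$ (possibly empty). For two elements $T_i,T_j$ sharing a facet, $\vec{\nu}_{i,j}(\vec{x})$ denotes the unit normal vector to $\partial T_i$, pointing outward from $T_i$, at points $\vec{x}$ of the facet(s) in $\mathcal{E}_{T_i,T_j}$. Voronoi tessellation. A Voronoi tessellation over a $d$-dimensional polytopal domain $\Omega$ is a polytopal mesh $(\mathcal{T},\mathcal{E})$ over $\Omega$ in which each element $T_i\in\mathcal{T}$ has an associated centre $\vec{v}_i\in\mathbb{R}^d$ (not required to lie in $\Omega$) such that $$T_i=\{\vec{x}\in\Omega : \|\vec{x}-\vec{v}_i\|_2<\|\vec{x}-\vec{v}_j\|_2 \text{ for all } j\neq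 i\}.$$ Directed dual mesh. For a direction $\vec{\omega}$, the directed dual mesh $\mathcal{M}^*_{\vec{\omega}}=(\mathcal{T}^*,\mathcal{E}^* )$ of a polytopal mesh $\mathcal{M}=(\mathcal{T},\mathcal{E})$ is the directed graph with vertex set $\mathcal{T}^*=\mathcal{T}$ and edge set $$\mathcal{E}^*=\{(T_i,T_j)\in\mathcal{T}\times\mathcal{T} : T_i\ne T_j,\ \mathcal{E}_{T_i,T_j}\neq\emptyset,\ \vec{\omega}\cdot\vec{\nu}_{i,j}(\vec{x})>0\},$$ where the last condition is for $\vec{x}$ on the shared facet(s) in $\mathcal{E}_{T_i,T_j}$. Pairs with $\vec{\omega}\cdot\vec{\nu}_{i,j}=0$ contribute no edge. *)

(* Defs.v *)
From HB Require Import structures.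
From mathcomp Require Import all_boot all_order all_algebra all_fingroup.
From mathcomp Require Import all_classical all_reals all_analysis.
Import Order.TTheory GRing.Theory Num.Theory.
Import numFieldNormedType.Exports.

Set Implicit Arguments.
Unset Strict Implicit.
Unset Printing Implicit Defensive.

Local Open Scope classical_set_scope.
Local Open Scope ring_scope.

(** * Euclidean geometry

    The canonical norm of ['rV[R]_d] is the sup norm, hence [l2norm] below.
    Its topology is the usual one of R^d. *)

Definition dot (R : realType) (d : nat) (u v : 'rV[R]_d) : R :=
  \sum_(k < d) u ord0 k * v ord0 k.

Definition l2norm (R : realType) (d : nat) (u : 'rV[R]_d) : R :=
  Num.sqrt (dot u u).

Definition unit_sphere (R : realType) (d : nat) : set 'rV[R]_d :=
  [set w | l2norm w = 1].

Definition boundary (T : topologicalType) (A : set T) : set T :=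
  closure A `\` A°.

Definition hyperplane (R : realType) (d : nat) (H : set 'rV[R]_d) : Prop :=
  exists a : 'rV[R]_d, exists b : R, a != 0 /\ H = [set x | dot a x = b].

(** * Polytopes

    A polytope need not be convex or connected (a Voronoi cell is the trace on
    a possibly non-convex domain of a convex set).  It is relatively open in
    its affine hull, in accordance with the convention that mesh elements are
    disjoint while only their closures cover the domain. *)

Definition convex_polytope (R : realType) (d : nat) (P : set 'rV[R]_d) : Prop :=
  bounded_set P /\
  exists (m : nat) (a : 'I_m -> 'rV[R]_d) (b : 'I_m -> R),
    P = [set x | forall i, dot (a i) x <= b i].

Definition convex_polytope_union (R : realType) (d : nat)
    (K : set 'rV[R]_d) : Prop :=
  exists (m : nat) (P : 'I_m -> set 'rV[R]_d),
    (forall i, convex_polytope (P i)) /\ K = \bigcup_i P i.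

Definition relative_interior (T : topologicalType) (A K : set T) : set T :=
  [set x | A x /\ \forall y \near x, A y -> K y].

Definition polytope_in (R : realType) (d : nat) (A P : set 'rV[R]_d) : Prop :=
  P !=set0 /\
  exists K : set 'rV[R]_d,
    [/\ convex_polytope_union K, K `<=` A & P = relative_interior A K].

(* Non-empty and open, hence d-dimensional; bounded, since convex polytopes
   are. *)
Definition polytope (R : realType) (d : nat) (P : set 'rV[R]_d) : Prop :=
  polytope_in setT P.

(* A (d-1)-dimensional polytope. *)
Definition flat_facet (R : realType) (d : nat) (F : set 'rV[R]_d) : Prop :=
  exists2 H : set 'rV[R]_d, hyperplane H & polytope_in H F.

Definition polytopal_domain (R : realType) (d : nat)
    (Omega : set 'rV[R]_d) : Prop :=
  polytope Omega /\ connected Omega.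

(* Near [x], the set [A] is the open half-space through [x] with outward
   normal [nu].  This determines [nu]; for a polytope such a [nu] exists at all
   boundary points outside a set of dimension at most d-2. *)
Definition outward_unit_normal (R : realType) (d : nat) (A : set 'rV[R]_d)
    (x nu : 'rV[R]_d) : Prop :=
  l2norm nu = 1 /\ \forall y \near x, A y <-> dot nu (y - x) < 0.

(** * Meshes *)

(* [facets_of T E i] is E_{T_i}. *)
Definition facets_of (R : realType) (d N : nat) (T : 'I_N -> set 'rV[R]_d)
    (E : set (set 'rV[R]_d)) (i : 'I_N) : set (set 'rV[R]_d) :=
  [set F | E F /\ F `<=` boundary (T i)].

(* [shared_facets T E i j] is E_{T_i,T_j}. *)
Definition shared_facets (R : realType) (d N : nat)
    (T : 'I_N -> set 'rV[R]_d) (E : set (set 'rV[R]_d))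
    (i j : 'I_N) : set (set 'rV[R]_d) :=
  facets_of T E i `&` facets_of T E j.

(* Facets being relatively open, they partition the skeleton up to their
   lower-dimensional faces: they are disjoint and their closures cover it.  The
   covering is required element by element, so that every facet of [E] lying on
   an element's boundary is really a facet of the subdivision and cannot
   straddle the boundaries of two elements. *)
Record polytopal_mesh (R : realType) (d N : nat) (Omega : set 'rV[R]_d)
    (T : 'I_N -> set 'rV[R]_d) (E : set (set 'rV[R]_d)) : Prop := {
  mesh_element_polytope : forall i, polytope (T i);
  mesh_element_sub : forall i, T i `<=` Omega;
  mesh_element_disjoint : forall i j, i != j -> T i `&` T j = set0;
  mesh_element_cover : closure Omega = \bigcup_i closure (T i);
  mesh_facet_finite : finite_set E;
  mesh_facet_flat : forall F, E F -> flat_facet F;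
  mesh_facet_of_element : forall F, E F -> exists i, facets_of T E i F;
  mesh_facet_disjoint : forall F G, E F -> E G -> F <> G -> F `&` G = set0;
  mesh_facet_cover : forall i,
    boundary (T i) = \bigcup_(F in facets_of T E i) closure F
}.

Record voronoi_tessellation (R : realType) (d N : nat) (Omega : set 'rV[R]_d)
    (T : 'I_N -> set 'rV[R]_d) (E : set (set 'rV[R]_d))
    (v : 'I_N -> 'rV[R]_d) : Prop := {
  voronoi_mesh : polytopal_mesh Omega T E;
  voronoi_cell : forall i,
    T i = [set x | Omega x /\
                   forall j, j != i -> l2norm (x - v i) < l2norm (x - v j)]
}.

(* Edge relation of the directed dual mesh, on the indices of the elements.
   The sign condition bears on the points of the shared facets at which the
   normal to the boundary of [T i] is defined. *)
Definition dual_edge (R : realType) (d N : nat) (T : 'I_N -> set 'rV[R]_d)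
    (E : set (set 'rV[R]_d)) (w : 'rV[R]_d) (i j : 'I_N) : Prop :=
  [/\ T i <> T j,
      shared_facets T E i j !=set0 &
      forall F x nu, shared_facets T E i j F -> F x ->
        outward_unit_normal (T i) x nu -> 0 < dot w nu].

Definition topological_sort (N : nat) (edge : 'I_N -> 'I_N -> Prop)
    (pi : {perm 'I_N}) : Prop :=
  forall p q : 'I_N, edge (pi p) (pi q) -> (p < q)%N.

(** * Real-RAM programs

    Real numbers live only in memory cells and influence the control flow only
    through comparisons.  Cells are grouped into arrays rather than numbered:
    [Centre i k] and [Dir k] hold the coordinates of the centres and of the
    direction, [Delta i] the list of the delta_i, [Out p] the returned
    ordering; the other cells are scratch. *)

Inductive rcell : Type :=
| Centre of nat & nat
| Dir of nat
| Delta of nat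
| Acc
| Prod
| RWork of nat.

Inductive icell : Type :=
| Out of nat
| IWork of nat.

HB.instance Definition _ := gen_eqMixin rcell.
HB.instance Definition _ := gen_eqMixin icell.

Definition cell : Type := (rcell + icell)%type.

Record memory (R : Type) : Type := Memory {
  rmem : rcell -> R;
  imem : icell -> nat
}.

Definition set_rmem (R : Type) (m : memory R) (c : rcell) (x : R) : memory R :=
  Memory (fun c' => if c' == c then x else rmem m c') (imem m).

Definition set_imem (R : Type) (m : memory R) (c : icell) (n : nat) : memory R :=
  Memory (rmem m) (fun c' => if c' == c then n else imem m c').

Inductive arith_op : Type := RAdd | RSub | RMul | RDiv.

Definition eval_op (R : realType) (o : arith_op) (x y : R) : R :=
  match o with
  | RAdd => x + y
  | RSub => x - y
  | RMul => x * y
  | RDiv => x / y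
  end.

(* The destination cell comes first. *)
Inductive prog (R : Type) : Type :=
| Done
| SetReal of rcell & R & prog R
| CopyReal of rcell & rcell & prog R
| Arith of arith_op & rcell & rcell & rcell & prog R
| Compare of rcell & rcell & (bool -> prog R)
| SetIndex of icell & nat & prog R
| GetIndex of icell & (nat -> prog R).

Arguments Done {R}.

(* Final memory, and the list of the cells accessed by each executed
   instruction. *)
Fixpoint exec (R : realType) (p : prog R) (m : memory R) :
    memory R * seq (seq cell) :=
  match p with
  | Done => (m, [::])
  | SetReal c x p' =>
      let r := exec p' (set_rmem m c x) in
      (r.1, [:: inl c] :: r.2)
  | CopyReal c c1 p' =>
      let r := exec p' (set_rmem m c (rmem m c1)) in
      (r.1, [:: inl c; inl c1] :: r.2)
  | Arith o c c1 c2 p' =>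
      let r := exec p' (set_rmem m c (eval_op o (rmem m c1) (rmem m c2))) in
      (r.1, [:: inl c; inl c1; inl c2] :: r.2)
  | Compare c1 c2 k =>
      let r := exec (k (rmem m c1 <= rmem m c2)) m in
      (r.1, [:: inl c1; inl c2] :: r.2)
  | SetIndex c n p' =>
      let r := exec p' (set_imem m c n) in
      (r.1, [:: inr c] :: r.2)
  | GetIndex c k =>
      let r := exec (k (imem m c)) m in
      (r.1, [:: inr c] :: r.2)
  end.

Definition final_memory (R : realType) (p : prog R) (m : memory R) : memory R :=
  (exec p m).1.

(* Number of executed instructions. *)
Definition time_cost (R : realType) (p : prog R) (m : memory R) : nat :=
  size (exec p m).2.

(* Number of distinct cells accessed, including those holding the input. *)
Definition space_cost (R : realType) (p : prog R) (m : memory R) : nat :=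
  size (undup (flatten (exec p m).2)).

Definition returned_ordering (R : Type) (N : nat) (m : memory R)
    (pi : {perm 'I_N}) : Prop :=
  forall p : 'I_N, imem m (Out p) = pi p :> nat.

(** * The Voronoi-Scheduler *)

Definition is_argsort (R : realType) (N : nat) (delta : 'I_N -> R)
    (pi : {perm 'I_N}) : Prop :=
  forall p q : 'I_N, (p <= q)%N -> delta (pi p) <= delta (pi q).

(* [sort n] performs an argsort, with ties ordered arbitrarily, of the list
   stored in [Delta 0], ..., [Delta (n - 1)], within O(n ln n) operations and
   O(n) space.  The summand 1 is only there for n = 1, where n ln n = 0. *)
Definition standard_argsort (R : realType) (sort : nat -> prog R) : Prop :=
  (forall (n : nat) (m : memory R), exists pi : {perm 'I_n},
     returned_ordering (final_memory (sort n) m) pi /\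
     is_argsort (fun i : 'I_n => rmem m (Delta i)) pi) /\
  exists C : R, forall (n : nat) (m : memory R), (0 < n)%N ->
    (time_cost (sort n) m)%:R <= C * (n%:R * ln n%:R + 1) /\
    (space_cost (sort n) m)%:R <= C * n%:R.

(* Computes delta_i, stores it in the list and continues with [next]. *)
Definition compute_delta (R : realType) (d i : nat) (next : prog R) : prog R :=
  SetReal Acc 0
    (foldr (fun k p => Arith RMul Prod (Dir k) (Centre i k)
                         (Arith RAdd Acc Acc Prod p))
           (CopyReal (Delta i) Acc next) (iota 0 d)).

Definition voronoi_scheduler (R : realType) (sort : nat -> prog R)
    (d N : nat) : prog R :=
  foldr (@compute_delta R d) (sort N) (iota 0 N).

Definition input_loaded (R : realType) (d N : nat) (v : 'I_N -> 'rV[R]_d)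
    (w : 'rV[R]_d) (m : memory R) : Prop :=
  (forall (i : 'I_N) (k : 'I_d), rmem m (Centre i k) = v i ord0 k) /\
  (forall k : 'I_d, rmem m (Dir k) = w ord0 k).

(* Main.v *)
(** A shared facet F of T_i and T_j lies in the bisector of v_i and v_j, and,
    being relatively open in a hyperplane, it spans that bisector.  The finitely
    many other facets of T_i cannot cover F: those in other hyperplanes meet the
    bisector in nowhere dense sets, and those in the bisector are disjoint from
    F.  Near a point of F off their closures, the boundary of T_i lies in the
    bisector, hence, by connectedness, T_i is exactly the open half-ball on the
    side of v_i.  So the outward normal there is the normalisation of v_j - v_i,
    and an edge from T_i to T_j forces w.v_i < w.v_j; sorting the values w.v_i
    is therefore a topological sort. *)
Require Import Defs.
From mathcomp Require Import all_boot all_order all_algebra all_fingroup.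
From mathcomp Require Import all_classical all_reals all_analysis.
From mathcomp Require Import lra ring zify.
Import Order.TTheory GRing.Theory Num.Theory.
Import numFieldNormedType.Exports.

Set Implicit Arguments.
Unset Strict Implicit.
Unset Printing Implicit Defensive.

Local Open Scope ring_scope.
Local Open Scope classical_set_scope.

(** * The Euclidean inner product *)

Lemma dotC (R : realType) (d : nat) (u v : 'rV[R]_d) : dot u v = dot v u.
Proof. by apply: eq_bigr => k _; rewrite mulrC. Qed.

Lemma dotDr (R : realType) (d : nat) (u v w : 'rV[R]_d) :
  dot u (v + w) = dot u v + dot u w.
Proof. by rewrite -big_split; apply: eq_bigr => k _; rewrite mxE mulrDr. Qed.

Lemma dotZr (R : realType) (d : nat) (a : R) (u v : 'rV[R]_d) :
  dot u (a *: v) = a * dot u v.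
Proof. by rewrite mulr_sumr; apply: eq_bigr => k _; rewrite mxE mulrCA. Qed.

Lemma dotBr (R : realType) (d : nat) (u v w : 'rV[R]_d) :
  dot u (v - w) = dot u v - dot u w.
Proof. by rewrite -scaleN1r dotDr dotZr mulN1r. Qed.

Lemma dotBl (R : realType) (d : nat) (u v w : 'rV[R]_d) :
  dot (u - v) w = dot u w - dot v w.
Proof. by rewrite dotC dotBr !(dotC _ w). Qed.

Lemma dot_ge0 (R : realType) (d : nat) (u : 'rV[R]_d) : 0 <= dot u u.
Proof. by apply: sumr_ge0 => k _; rewrite -expr2 sqr_ge0. Qed.

Lemma dot_eq0 (R : realType) (d : nat) (u : 'rV[R]_d) :
  (dot u u == 0) = (u == 0).
Proof.
apply/idP/eqP => [|->]; last first.
  by rewrite /dot big1 // => k _; rewrite mxE mul0r.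
rewrite psumr_eq0 => [/allP u0|k _]; last by rewrite -expr2 sqr_ge0.
apply/rowP => k; have := u0 k (mem_index_enum k).
by rewrite mulf_eq0 orbb mxE => /eqP.
Qed.

Lemma dot_continuous (R : realType) (d : nat) (a : 'rV[R]_d) :
  continuous (dot a).
Proof.
rewrite /dot; apply: continuous_big => [|k _]; first exact: add_continuous.
by move=> x; exact: cvgM (cvg_cst _) (@coord_continuous R 1 d ord0 k x).
Qed.

Lemma line_continuous (R : realType) (d : nat) (x u : 'rV[R]_d) :
  continuous (fun t : R => x + t *: u).
Proof.
move=> t; apply: (@cvgD _ _ _ _ _ (cst x)); first exact: cvg_cst.
by apply: cvgZ; [exact: cvg_id|exact: cvg_cst].
Qed.

(** * Hyperplanes *)

Lemma hyperplane_closed (R : realType) (d : nat) (H : set 'rV[R]_d) :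
  hyperplane H -> closed H.
Proof.
move=> [a [b [_ ->]]]; rewrite -[X in closed X]/(dot a @^-1` [set y | y = b]).
by apply: preimage_closed; [move=> x _; exact: dot_continuous|exact: closed_eq].
Qed.

Lemma hyperplane_inhabited (R : realType) (d : nat) (a : 'rV[R]_d) (b : R) :
  a != 0 -> exists x, dot a x = b.
Proof.
rewrite -dot_eq0 => a0; exists ((b / dot a a) *: a).
by rewrite dotZr divfK.
Qed.

(** The component [u] of [c] orthogonal to [a] is a direction of [G], hence of [H], so it is
    orthogonal to [c] as well. Then [dot u u = 0], and [c] is a nonzero multiple of [a]. *)
Lemma hyperplane_sub_eq (R : realType) (d : nat) (G H : set 'rV[R]_d) :
  hyperplane G -> hyperplane H -> G `<=` H -> G = H.
Proof.
move=> [a [b [a0 ->]]] [c [e [c0 ->]]] sub.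
have [p ap] := hyperplane_inhabited b a0; have cp := sub _ ap.
have aa0 : dot a a != 0 by rewrite dot_eq0.
pose l := dot a c / dot a a; pose u := c - l *: a.
have au : dot a u = 0 by rewrite dotBr dotZr divfK ?subrr.
have cu : dot c u = 0.
  have : dot c (p + u) = e by apply: sub; rewrite /= dotDr au addr0.
  by rewrite dotDr cp => cpu; apply: (addrI e); rewrite cpu addr0.
have /eqP : dot u u == 0.
  by rewrite {2}/u dotBr dotZr !(dotC u) cu au mulr0 subrr.
move=> /eqP; rewrite dot_eq0 subr_eq0 => /eqP cE.
have l0 : l != 0 by apply: contra c0 => /eqP l0; rewrite cE l0 scale0r.
apply/seteqP; split=> x; first exact: sub.
have cl y : dot c y = l * dot a y by rewrite dotC {1}cE dotZr dotC.
by move=> /= cx; apply: (mulfI l0); rewrite -ap -!cl cx cp.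
Qed.

(** * Generic points of relatively open facets *)

Lemma relative_interior_near (T : topologicalType) (A K : set T) (x : T) :
  relative_interior A K x ->
  \forall y \near x, A y -> relative_interior A K y.
Proof.
move=> [_ /near_join]; apply: filterS => y Ky Ay; split=> //.
Qed.

(** Some [z] in [H] lies off [C]. If [x] is in [C], a short move from [x] towards [z] stays in [F],
    and it leaves [C] because the affine equation of [C] holds at [x] but not at [z]. *)
Lemma relatively_open_escape (R : realType) (d : nat) (F H C : set 'rV[R]_d)
    (x : 'rV[R]_d) :
  hyperplane H -> hyperplane C -> H <> C ->
  F `<=` H -> F x -> (\forall y \near x, H y -> F y) ->
  exists2 y, F y & ~ C y.
Proof.
move=> hH hC HC FH Fx nF.
have [z Hz nCz] : exists2 z, H z & ~ C z.
  apply: contrapT => nex; apply: HC; apply: hyperplane_sub_eq => // z Hz.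
  by apply: contrapT => nCz; apply: nex; exists z.
have [Cx|nCx] := pselect (C x); last by exists x.
have : \forall t \near (0 : R), H (x + t *: (z - x)) -> F (x + t *: (z - x)).
  have cl := @line_continuous R d x (z - x) (0 : R).
  by rewrite /continuous_at scale0r addr0 in cl; exact: cl _ nF.
move=> /nbhs_ballP[e /= e0 ballF].
have hF : H (x + (e / 2) *: (z - x)) -> F (x + (e / 2) *: (z - x)).
  by apply: ballF; rewrite /ball /= sub0r normrN gtr0_norm; lra.
exists (x + (e / 2) *: (z - x)).
  apply: hF; have := FH _ Fx; case: hH Hz => a [b [_ ->]] /= az ax.
  by rewrite dotDr dotZr dotBr az ax subrr mulr0 addr0.
case: hC Cx nCz => a [b [_ ->]] /= ax naz.
rewrite dotDr dotZr dotBr ax => eb; apply: naz.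
have /eqP : e / 2 * (dot a z - b) = 0 by apply: (addrI b); rewrite eb addr0.
by rewrite mulf_eq0 subr_eq0 => /orP[/eqP|/eqP//]; lra.
Qed.

(** The closures are removed one at a time: what remains of [F] is still non-empty and relatively
    open in [H], so the induction runs over all such [F]. *)
Lemma generic_facet_point (R : realType) (d : nat) (F H : set 'rV[R]_d)
    (s : seq (set 'rV[R]_d)) :
  hyperplane H -> F `<=` H -> F !=set0 ->
  (forall x, F x -> \forall y \near x, H y -> F y) ->
  (forall G, G \in s -> flat_facet G /\ G `&` F = set0) ->
  exists2 x, F x & forall G, G \in s -> ~ closure G x.
Proof.
move=> hH; elim: s F => [|G s IHs] F FH [x Fx] nF sF; first by exists x.
have [[C hC [G0 [K [_ _ GE]]]] GF] := sF G (mem_head _ _).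
have GC : G `<=` C by rewrite GE => y [].
have nclG : exists2 y, F y & ~ closure G y.
  (* In distinct hyperplanes, [F] escapes the closed set [C], which contains [closure G]. In the
     same one, [F] is a neighbourhood within [C] of each of its points, so a point of [closure G] in
     [F] would make [G] meet [F]. *)
  have [HC|HC] := pselect (H = C); last first.
    have [y Fy nCy] := relatively_open_escape hH hC HC FH Fx (nF x Fx).
    exists y => // /(closureS GC) Cy; apply: nCy.
    exact: (hyperplane_closed hC).
  exists x => // /(_ _ (nF x Fx)) [y [Gy Fy]].
  suff : (G `&` F) y by rewrite GF.
  by split=> //; apply: Fy; rewrite HC; exact: GC.
have [y [Fy nGy] sy] : exists2 y, (F `&` ~` closure G) y &
    forall G', G' \in s -> ~ closure G' y.
  apply: IHs.
  - by move=> y [/FH].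
  - by case: nclG => y ? ?; exists y.
  - move=> y [Fy nGy].
    have : nbhs y (~` closure G).
      apply: open_nbhs_nbhs; split=> //.
      by apply: closed_openC; exact: closed_closure.
    by apply: filterS2 (nF y Fy) => z Fz nGz Hz; split=> //; exact: Fz.
  - move=> G' G's; have [|ff G'F] := sF G'; first by rewrite inE G's orbT.
    by split=> //; rewrite setIA G'F set0I.
by exists y => // G'; rewrite inE => /orP[/eqP->|/sy].
Qed.

(** * Convexity, half-spaces and distances *)

(** A segment from a point of [A] in [T] to any point of [A] stays in [A], where [T] and [closure T]
    agree. Its trace on [T] is thus open, closed and non-empty in [[0, 1]], which is connected. *)
Lemma open_segment_subset (R : realType) (d : nat) (A T : set 'rV[R]_d) :
  (forall x y t, A x -> A y -> 0 <= t <= 1 -> A (x + t *: (y - x))) ->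
  open T -> A `&` boundary T = set0 -> A `&` T !=set0 -> A `<=` T.
Proof.
move=> cA oT AT [x [Ax Tx]] y Ay.
pose f (t : R) := x + t *: (y - x).
have clT z : A z -> closure T z -> T z.
  move=> Az clz; apply: contrapT => nTz.
  suff : (A `&` boundary T) z by rewrite AT.
  by split=> //; split=> // /interior_subset.
have fA t : `[0, 1] t -> A (f t) by rewrite /= in_itv; exact: cA.
have E : `[0, 1] `&` f @^-1` T = `[0, 1].
  apply: (@segment_connected R 0 1).
  - exists 0; split; first by rewrite /= in_itv /= lexx ler01.
    by rewrite /f /= scale0r addr0.
  - exists (f @^-1` T) => //.
    by apply: open_comp => // t _; exact: line_continuous.
  - exists (f @^-1` closure T).
      apply: preimage_closed; last exact: closed_closure.
      by move=> t _; exact: line_continuous.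
    apply/seteqP; split=> t [t01 Tt]; split=> //; first exact: subset_closure.
    by apply: clT => //; exact: fA.
have : (`[0, 1] `&` f @^-1` T) 1 by rewrite E /= in_itv /= lexx ler01.
by case=> _; rewrite /f /= scale1r subrKC.
Qed.

(** After squaring, [dot x x] cancels, so comparing the distances to two points is an affine
    condition on [x]. *)
Lemma l2norm_sub_le (R : realType) (d : nat) (x u v : 'rV[R]_d) :
  (l2norm (x - u) <= l2norm (x - v))
  = (2 * dot (v - u) x <= dot v v - dot u u).
Proof.
have E w : dot (x - w) (x - w) = dot x x - 2 * dot w x + dot w w.
  by rewrite dotBl !dotBr [dot x w]dotC; ring.
rewrite ler_sqrt ?dot_ge0 // !E dotBl.
by apply/idP/idP; lra.
Qed.

Lemma l2norm_sub_lt (R : realType) (d : nat) (x u v : 'rV[R]_d) :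
  (l2norm (x - u) < l2norm (x - v))
  = (2 * dot (v - u) x < dot v v - dot u u).
Proof.
rewrite ltNge l2norm_sub_le !dotBl.
by apply/idP/idP; lra.
Qed.

Lemma l2norm_gt0 (R : realType) (d : nat) (u : 'rV[R]_d) :
  u != 0 -> 0 < l2norm u.
Proof. by move=> u0; rewrite sqrtr_gt0 lt_def dot_eq0 u0 dot_ge0. Qed.

Lemma l2norm_normalized (R : realType) (d : nat) (u : 'rV[R]_d) :
  u != 0 -> l2norm ((l2norm u)^-1 *: u) = 1.
Proof.
move=> u0; have n0 := l2norm_gt0 u0.
rewrite {1}/l2norm dotZr dotC dotZr -[dot u u]sqr_sqrtr ?dot_ge0 //.
by rewrite -/(l2norm u) expr2 !mulKf ?sqrtr1 ?mulVf ?sqrtr1 ?gt_eqF.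
Qed.

Lemma closed_halfspace (R : realType) (d : nat) (a : 'rV[R]_d) (b : R) :
  closed [set x | dot a x <= b].
Proof.
rewrite -[X in closed X]/(dot a @^-1` [set y | y <= b]).
by apply: preimage_closed; [move=> x _; exact: dot_continuous|exact: closed_le].
Qed.

Lemma convex_combination_lt (R : realFieldType) (x y c t : R) :
  x < c -> y < c -> 0 <= t <= 1 -> (1 - t) * x + t * y < c.
Proof.
(* One of the weights is at least 1/2, hence positive, and its term makes the inequality strict. *)
move=> xc yc /andP[t0 t1]; have [t2|t2] := lerP t 2^-1.
  have : 0 < (1 - t) * (c - x) by apply: mulr_gt0; lra.
  have : 0 <= t * (c - y) by apply: mulr_ge0; lra.
  lra.
have : 0 <= (1 - t) * (c - x) by apply: mulr_ge0; lra.
have : 0 < t * (c - y) by apply: mulr_gt0; lra.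
lra.
Qed.

Lemma polytope_open (R : realType) (d : nat) (P : set 'rV[R]_d) :
  polytope P -> open P.
Proof.
move=> [_ [K [_ _ ->]]]; rewrite openE => x /relative_interior_near.
by apply: filterS => y; exact.
Qed.

(** * Voronoi cells, their shared facets and normals *)

(** The points equidistant from [u] and [v], in linear form; a hyperplane with normal [v - u] when
    [u] and [v] differ. *)
Definition bisector (R : realType) (d : nat) (u v : 'rV[R]_d) : set 'rV[R]_d :=
  [set x | dot (v - u) x = (dot v v - dot u u) / 2].

Lemma voronoi_cell_nearer (R : realType) (d N : nat) (Omega : set 'rV[R]_d)
    (T : 'I_N -> set 'rV[R]_d) (E : set (set 'rV[R]_d)) (v : 'I_N -> 'rV[R]_d)
    (i j : 'I_N) (x : 'rV[R]_d) :
  voronoi_tessellation Omega T E v -> i != j -> T i x ->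
  dot (v j - v i) x < (dot (v j) (v j) - dot (v i) (v i)) / 2.
Proof.
move=> vor ij; rewrite (voronoi_cell vor) => -[_ /(_ j)].
by rewrite eq_sym l2norm_sub_lt => /(_ ij); lra.
Qed.

(** Cells are non-empty, and at a point of [T i] equal centres would give [0 < 0]. *)
Lemma voronoi_centre_neq (R : realType) (d N : nat) (Omega : set 'rV[R]_d)
    (T : 'I_N -> set 'rV[R]_d) (E : set (set 'rV[R]_d)) (v : 'I_N -> 'rV[R]_d)
    (i j : 'I_N) :
  voronoi_tessellation Omega T E v -> i != j -> v j - v i != 0.
Proof.
move=> vor ij; have [[x Tix] _] := mesh_element_polytope (voronoi_mesh vor) i.
have := voronoi_cell_nearer vor ij Tix.
apply: contraTneq => /[dup] vij /eqP; rewrite subr_eq0 => /eqP ->.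
by rewrite !subrr dotC /dot big1 ?mul0r ?ltxx // => k _; rewrite mxE mulr0.
Qed.

(** A point of the facet is in the closure of both cells, where their opposite strict inequalities
    become weak and together force equality. *)
Lemma voronoi_shared_facet_bisector (R : realType) (d N : nat)
    (Omega : set 'rV[R]_d) (T : 'I_N -> set 'rV[R]_d)
    (E : set (set 'rV[R]_d)) (v : 'I_N -> 'rV[R]_d) (i j : 'I_N)
    (F : set 'rV[R]_d) :
  voronoi_tessellation Omega T E v -> i != j -> shared_facets T E i j F ->
  F `<=` bisector (v i) (v j).
Proof.
move=> vor ij [[_ Fi] [_ Fj]] x Fx.
have nearer k l : k != l -> boundary (T k) x ->
    dot (v l - v k) x <= (dot (v l) (v l) - dot (v k) (v k)) / 2.
  move=> kl [clx _]; apply: (@closed_halfspace _ _ (v l - v k)).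
  apply: closureS clx => y Tky; apply: ltW.
  exact: (voronoi_cell_nearer vor kl Tky).
have := nearer i j ij (Fi _ Fx); have := nearer j i; rewrite eq_sym => /(_ ij).
move=> /(_ (Fj _ Fx)); rewrite /bisector /= !dotBl => le1 le2.
by apply/eqP; rewrite eq_le; apply/andP; split; lra.
Qed.

(** The sign condition of [dual_edge] ranges over points having a normal, so it is informative only
    once such a point is exhibited, together with its normal. *)
Lemma voronoi_facet_normal (R : realType) (d N : nat)
    (Omega : set 'rV[R]_d) (T : 'I_N -> set 'rV[R]_d)
    (E : set (set 'rV[R]_d)) (v : 'I_N -> 'rV[R]_d) (i j : 'I_N)
    (F : set 'rV[R]_d) :
  voronoi_tessellation Omega T E v -> i != j -> shared_facets T E i j F ->
  exists2 x, F x &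
    outward_unit_normal (T i) x ((l2norm (v j - v i))^-1 *: (v j - v i)).
Proof.
move=> vor ij Fij; have mesh := voronoi_mesh vor.
have vij := voronoi_centre_neq vor ij.
have FB := voronoi_shared_facet_bisector vor ij Fij.
have nearer := voronoi_cell_nearer vor ij.
move: Fij FB => [[EF Fi] _]; set B := bisector _ _ => FB.
set b := (dot (v j) (v j) - dot (v i) (v i)) / 2 in B FB nearer *.
have hB : hyperplane B by exists (v j - v i), b.
have [H hH [F0 [K [_ _ FE]]]] := mesh_facet_flat mesh EF.
have nF x : F x -> \forall y \near x, H y -> F y.
  by rewrite FE; exact: relative_interior_near.
have HB : H = B.
  apply: contrapT => HB; have [x Fx] := F0.
  have [|y Fy] := relatively_open_escape hH hB HB _ Fx (nF x Fx).
    by rewrite FE => y [].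
  by apply; exact: FB.
have /finite_seqP[s sE] := (mesh_facet_finite mesh).
(* The point avoids every other facet of the mesh: these are finitely many and disjoint from [F]. *)
have [|G|x Fx nclx] :=
  @generic_facet_point _ _ F B [seq G <- s | G != F] hB FB F0.
- by rewrite -HB.
- rewrite mem_filter => /andP[/eqP GF Gs].
  have EG : E G by rewrite sE.
  split; first exact: (mesh_facet_flat mesh EG).
  exact: (mesh_facet_disjoint mesh EG EF GF).
have clTx : closure (T i) x by have [] := Fi _ Fx.
have Bx : dot (v j - v i) x = b := FB _ Fx.
have bdB : \forall y \near x, boundary (T i) y -> B y.
  have : nbhs x (~` \big[setU/set0]_(G <- [seq G <- s | G != F]) closure G).
    apply: open_nbhs_nbhs; split.
      apply: closed_openC; apply: closed_bigsetU => G _.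
      exact: closed_closure.
    by rewrite -bigcup_seq => -[G Gs /(nclx _ Gs)].
  (* The facets covering the boundary of [T i] near [x] reduce to [F], whose closure stays in the
     closed set [B]. *)
  apply: filterS => y ncly; rewrite (mesh_facet_cover mesh) => -[G [EG _] clGy].
  have [GF|GF] := eqVneq G F.
    by apply: (hyperplane_closed hB); apply: closureS clGy; rewrite GF.
  exfalso; apply: ncly; rewrite -bigcup_seq; exists G => //=.
  by rewrite mem_filter GF; move: EG; rewrite sE.
have [e /= e0 bdBe] := (nbhs_ballP _ _).1 bdB.
(* This open half-ball is convex, misses the boundary of [T i], which lies in [B] within the ball,
   and meets [T i] because [x] is in its closure. The ball is that of the sup norm. *)
pose A := ball x e `&` [set y | dot (v j - v i) y < b].
have AT : A `<=` T i.
  apply: open_segment_subset.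
  - move=> y z t; rewrite /A -!ball_normE /= => -[xy yb] [xz zb] t01.
    split; last first.
      rewrite dotDr dotZr dotBr.
      by have := convex_combination_lt yb zb t01; lra.
    have -> : x - (y + t *: (z - y)) = (1 - t) *: (x - y) + t *: (x - z).
      by apply/rowP => k; rewrite !mxE; ring.
    apply: le_lt_trans (ler_normD _ _) _; rewrite !normrZ.
    have /andP[t0 t1] := t01.
    by rewrite (ger0_norm t0) ger0_norm ?subr_ge0 // convex_combination_lt.
  - exact: polytope_open (mesh_element_polytope mesh i).
  - apply/seteqP; split=> // y [[xy /= yb] /(bdBe _ xy) By].
    by move: yb; rewrite (By : dot (v j - v i) y = b) ltxx.
  - have [y [Ty xy]] := clTx _ (nbhsx_ballx x e e0).
    by exists y; split=> //; split=> //; exact: nearer.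
exists x => //; split; first exact: l2norm_normalized.
apply: filterS (nbhsx_ballx x e e0) => y xy.
rewrite dotC dotZr dotC dotBr Bx pmulr_rlt0 ?invr_gt0 ?l2norm_gt0 // subr_lt0.
by split=> [/nearer//|yb]; apply: AT; split.
Qed.

Lemma voronoi_dual_edge_lt (R : realType) (d N : nat)
    (Omega : set 'rV[R]_d) (T : 'I_N -> set 'rV[R]_d)
    (E : set (set 'rV[R]_d)) (v : 'I_N -> 'rV[R]_d) (w : 'rV[R]_d)
    (i j : 'I_N) :
  voronoi_tessellation Omega T E v -> dual_edge T E w i j ->
  dot w (v i) < dot w (v j).
Proof.
move=> vor [Tij [F Fij] pos].
have ij : i != j by apply: contra_notN Tij => /eqP->.
have [x Fx normal] := voronoi_facet_normal vor ij Fij.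
have := pos _ _ _ Fij Fx normal; rewrite dotZr dotBr pmulr_rgt0 ?subr_gt0 //.
by rewrite invr_gt0 l2norm_gt0 // (voronoi_centre_neq vor ij).
Qed.

(** * Execution of the program: values, time and space *)

(* [L] is any superset of the accessed cells; in the end it bounds the space. *)
Lemma exec_dot_loop (R : realType) (L : pred cell) (i : nat) (s : seq nat)
    (next : prog R) (m : memory R) :
  L (inl Acc) -> L (inl Prod) ->
  {in s, forall k, L (inl (Dir k)) && L (inl (Centre i k))} ->
  exists (m' : memory R) (t : seq (seq cell)),
    [/\ exec (foldr (fun k p => Arith RMul Prod (Dir k) (Centre i k)
                                  (Arith RAdd Acc Acc Prod p)) next s) m
          = ((exec next m').1, t ++ (exec next m').2),
        size t = (2 * size s)%N,
        all L (flatten t),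
        rmem m' Acc = rmem m Acc
          + \sum_(k <- s) rmem m (Dir k) * rmem m (Centre i k) &
        forall c, c <> Acc -> c <> Prod -> rmem m' c = rmem m c].
Proof.
move=> LAcc LProd; elim: s m => [|k s IHs] m Ls.
  exists m, [::]; split=> //; first by case: (exec next m).
  by rewrite big_nil addr0.
set m1 := set_rmem m Prod (rmem m (Dir k) * rmem m (Centre i k)).
set m2 := set_rmem m1 Acc (rmem m1 Acc + rmem m1 Prod).
have m2E c : c <> Acc -> c <> Prod -> rmem m2 c = rmem m c.
  by move=> /eqP/negPf cA /eqP/negPf cP; rewrite /= cA cP.
have /andP[LDir LCentre] := Ls k (mem_head k s).
have [|m' [t [eqt szt Lt accm' frame]]] := IHs m2.
  by move=> l ls; apply: Ls; rewrite inE ls orbT.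
exists m', ([:: inl Prod; inl (Dir k); inl (Centre i k)]
            :: [:: inl Acc; inl Acc; inl Prod] :: t); split.
- by rewrite /= -/m1 -/m2 eqt.
- by rewrite /= szt; lia.
- by rewrite /= LProd LDir LCentre LAcc.
- rewrite accm'.
  have -> : rmem m2 Acc = rmem m Acc + rmem m (Dir k) * rmem m (Centre i k).
    by rewrite /= !eqxx (_ : (Acc == Prod) = false) //; apply/eqP.
  rewrite big_cons addrA; congr (_ + _).
  by apply: eq_bigr => l _; rewrite !m2E.
- by move=> c cA cP; rewrite frame // m2E.
Qed.

(** The cost is two instructions per coordinate, plus the reset of [Acc] and the copy into
    [Delta i]. The last clause ensures that the next centre finds its input intact. *)
Lemma exec_compute_delta (R : realType) (L : pred cell) (d i : nat)
    (next : prog R) (m : memory R) :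
  L (inl Acc) -> L (inl Prod) -> L (inl (Delta i)) ->
  (forall k, (k < d)%N -> L (inl (Dir k)) && L (inl (Centre i k))) ->
  exists (m' : memory R) (t : seq (seq cell)),
    [/\ exec (compute_delta d i next) m
          = ((exec next m').1, t ++ (exec next m').2),
        size t = (2 * d + 2)%N,
        all L (flatten t),
        rmem m' (Delta i)
          = \sum_(k < d) rmem m (Dir k) * rmem m (Centre i k) &
        forall c, c <> Acc -> c <> Prod -> c <> Delta i ->
          rmem m' c = rmem m c].
Proof.
move=> LAcc LProd LDelta Ld; set m0 := set_rmem m Acc 0.
have m0E c : c <> Acc -> rmem m0 c = rmem m c by move=> /eqP/negPf /= ->.
have [k|m1 [t [eqt szt Lt accm1 frame]]] :=
  @exec_dot_loop R L i (iota 0 d) (CopyReal (Delta i) Acc next) m0 LAcc LProd.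
  by rewrite mem_iota => /Ld.
exists (set_rmem m1 (Delta i) (rmem m1 Acc)),
  ([:: inl Acc] :: rcons t [:: inl (Delta i); inl Acc]); split.
- by rewrite /compute_delta [LHS]/= -/m0 eqt /= -cats1 -catA.
- by rewrite /= size_rcons szt size_iota; lia.
- by rewrite /= flatten_rcons all_cat Lt /= LAcc LDelta.
- rewrite -(big_mkord xpredT (fun k => rmem m (Dir k) * rmem m (Centre i k))).
  have m0Acc : rmem m0 Acc = 0 by rewrite /= eqxx.
  rewrite [LHS]/= eqxx accm1 m0Acc add0r /index_iota subn0.
  by apply: eq_bigr => k _; rewrite !m0E.
- move=> c cA cP /eqP/negPf cD /=.
  by rewrite cD frame // m0E.
Qed.

Lemma exec_compute_deltas (R : realType) (L : pred cell) (d : nat)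
    (s : seq nat) (next : prog R) (m : memory R) :
  L (inl Acc) -> L (inl Prod) ->
  {in s, forall i, L (inl (Delta i))} ->
  (forall k, (k < d)%N -> L (inl (Dir k))) ->
  (forall i k, i \in s -> (k < d)%N -> L (inl (Centre i k))) ->
  exists (m' : memory R) (t : seq (seq cell)),
    [/\ exec (foldr (@compute_delta R d) next s) m
          = ((exec next m').1, t ++ (exec next m').2),
        size t = (size s * (2 * d + 2))%N,
        all L (flatten t),
        {in s, forall i, rmem m' (Delta i) =
           \sum_(k < d) rmem m (Dir k) * rmem m (Centre i k)} &
        forall c, c <> Acc -> c <> Prod ->
          (forall i, i \in s -> c <> Delta i) -> rmem m' c = rmem m c].
Proof.
move=> LAcc LProd; elim: s m => [|i s IHs] m Ls Ld Lsd.
  by exists m, [::]; split=> //; case: (exec next m).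
have [||m1 [t1 [eqt1 szt1 Lt1 delta1 frame1]]] := @exec_compute_delta R L d i
    (foldr (@compute_delta R d) next s) m LAcc LProd.
- by apply: Ls; rewrite mem_head.
- by move=> k kd; rewrite Ld // Lsd // mem_head.
have [|//||m2 [t2 [eqt2 szt2 Lt2 delta2 frame2]]] := IHs m1.
- by move=> j js; apply: Ls; rewrite inE js orbT.
- by move=> j k js; apply: Lsd; rewrite inE js orbT.
exists m2, (t1 ++ t2); split.
- by rewrite -[foldr _ _ _]/(compute_delta d i (foldr _ next s)) eqt1
    eqt2 /= catA.
- by rewrite size_cat szt1 szt2 /=; lia.
- by rewrite flatten_cat all_cat Lt1 Lt2.
(* The list may repeat an index: if [j] recurs in the tail, [Delta j] is recomputed from the same
   input; otherwise [j] is the head and its value survives. *)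
- move=> j; case js: (j \in s); rewrite inE js.
    by move=> _; rewrite delta2 //; apply: eq_bigr => k _; rewrite !frame1.
  rewrite orbF => /eqP ji; rewrite -ji in delta1 *.
  by rewrite frame2 // => l ls [jl]; rewrite jl ls in js.
- move=> c cA cP cs; rewrite frame2 // ?frame1 //.
    by apply: cs; rewrite mem_head.
  by move=> j js; apply: cs; rewrite inE js orbT.
Qed.

Lemma size_undup_cat (T : eqType) (s t : seq T) :
  (size (undup (s ++ t)) <= size (undup s) + size (undup t))%N.
Proof.
rewrite -size_cat; apply: uniq_leq_size; first exact: undup_uniq.
by move=> x; rewrite mem_undup !mem_cat !mem_undup.
Qed.

(** Serves as the set [L] above: its length [2 + N + d + N * d] bounds the space used before the
    sort. *)
Definition scheduler_cells (d N : nat) : seq cell :=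
  [:: inl Acc; inl Prod] ++ [seq inl (Delta i) | i <- iota 0 N]
  ++ [seq inl (Dir k) | k <- iota 0 d]
  ++ [seq inl (Centre i k) | i <- iota 0 N, k <- iota 0 d].

(** The run splits at the memory [m'] handed to the sort. Times add up exactly; space is only
    bounded, since both phases may access the same cells. *)
Lemma exec_voronoi_scheduler (R : realType) (sort : nat -> prog R)
    (d N : nat) (v : 'I_N -> 'rV[R]_d) (w : 'rV[R]_d) (m : memory R) :
  input_loaded v w m ->
  exists m' : memory R,
    [/\ final_memory (voronoi_scheduler sort d N) m
          = final_memory (sort N) m',
        time_cost (voronoi_scheduler sort d N) m
          = (N * (2 * d + 2) + time_cost (sort N) m')%N,
        (space_cost (voronoi_scheduler sort d N) m
          <= 2 + N + d + N * d + space_cost (sort N) m')%N &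
        forall i : 'I_N, rmem m' (Delta i) = dot w (v i)].
Proof.
move=> [loadv loadw].
have [||i|k|i k|m' [t [eqt szt Lt deltaE _]]] := @exec_compute_deltas R
    (fun c => c \in scheduler_cells d N) d (iota 0 N) (sort N) m.
- by rewrite /= mem_head.
- by rewrite /= !inE eqxx orbT.
- move=> iN /=; rewrite /scheduler_cells !mem_cat (map_f (inl \o Delta)) //.
  by rewrite orbT.
- move=> kd /=; rewrite /scheduler_cells !mem_cat (map_f (inl \o Dir)) ?orbT //.
  by rewrite mem_iota.
- move=> iN kd /=; rewrite /scheduler_cells !mem_cat.
  rewrite (allpairs_f (fun i k => inl (Centre i k))) ?orbT //.
  by rewrite mem_iota.
exists m'; split.
- by rewrite /final_memory eqt.
- by rewrite /time_cost eqt /= size_cat szt size_iota.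
- rewrite /space_cost eqt /= flatten_cat.
  apply: leq_trans (size_undup_cat _ _) _; rewrite leq_add2r.
  have -> : (2 + N + d + N * d = size (scheduler_cells d N))%N.
    by rewrite !size_cat !size_map size_allpairs !size_iota /=; lia.
  apply: uniq_leq_size; first exact: undup_uniq.
  by move=> c; rewrite mem_undup => /(allP Lt).
- move=> i; rewrite deltaE ?mem_iota ?ltn_ord //.
  by apply: eq_bigr => k _; rewrite loadv loadw.
Qed.

(** * Correctness and complexity of the scheduler *)

(** The cost bounds of the sort are available only for a positive number of items; a point of
    [Omega] must lie in the closure of some cell. *)
Lemma polytopal_mesh_gt0 (R : realType) (d N : nat) (Omega : set 'rV[R]_d)
    (T : 'I_N -> set 'rV[R]_d) (E : set (set 'rV[R]_d)) :
  Omega !=set0 -> polytopal_mesh Omega T E -> (0 < N)%N.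
Proof.
move=> [x Ox] mesh; have : closure Omega x by exact: subset_closure.
by rewrite (mesh_element_cover mesh) => -[i _ _]; exact: leq_trans (ltn_ord i).
Qed.

Theorem mainTheorem2 (R : realType) (sort : nat -> prog R)
    (hsort : standard_argsort sort) :
  exists C : R,
    forall (d N : nat) (Omega : set 'rV[R]_d) (T : 'I_N -> set 'rV[R]_d)
      (E : set (set 'rV[R]_d)) (v : 'I_N -> 'rV[R]_d) (w : 'rV[R]_d)
      (m : memory R),
      (2 <= d)%N ->
      polytopal_domain Omega ->
      voronoi_tessellation Omega T E v ->
      unit_sphere w ->
      input_loaded v w m ->
      [/\ exists pi : {perm 'I_N},
            returned_ordering (final_memory (voronoi_scheduler sort d N) m) pi /\
            topological_sort (dual_edge T E w) pi,
          (time_cost (voronoi_scheduler sort d N) m)%:R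
            <= C * (N%:R * ln N%:R + d%:R * N%:R) &
          (space_cost (voronoi_scheduler sort d N) m)%:R <= C * (d%:R * N%:R)].
Proof.
(* The 4 pays for computing the list, as [2 * d + 2 <= 4 * d] and [2 + N + d + N * d <= 4 * (d * N)]
   for [d >= 2] and [N >= 1]. The absolute value is there because [C0] has unknown sign. *)
case: hsort => argsort [C0 cost]; exists (4 + `|C0|).
move=> d N Omega T E v w m d2 [polyO _] vor _ loaded.
have N0 := polytopal_mesh_gt0 polyO.1 (voronoi_mesh vor).
have [m' [finalE timeE space deltaE]] := exec_voronoi_scheduler sort loaded.
rewrite {}finalE {}timeE.
have [tsort ssort] := cost N m' N0.
have lnN : 0 <= N%:R * ln N%:R :> R by rewrite mulr_ge0 // ln_ge0 // ler1n.
have C0le (x y : R) : 0 <= x -> x <= y -> C0 * x <= `|C0| * y.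
  move=> x0 xy; apply: le_trans (ler_wpM2l _ xy) => //.
  by rewrite ler_wpM2r // ler_norm.
split.
- have [pi [out sorted]] := argsort N m'; exists pi; split=> // p q pq.
  (* The wrong order would contradict the strict increase along an edge; ties are therefore never
     joined by an edge. *)
  rewrite ltnNge; apply/negP => /sorted; rewrite !deltaE leNgt => /negP; apply.
  exact: voronoi_dual_edge_lt vor pq.
- have dN : (1 <= d * N)%N by nia.
  have tdelta : (N * (2 * d + 2) <= 4 * (d * N))%N by nia.
  rewrite natrD mulrDl; apply: lerD.
    apply: (@le_trans _ _ (4 * (d * N))%:R); first by rewrite ler_nat.
    by rewrite !natrM; apply: ler_wpM2l => //; rewrite lerDr.
  (* The summand 1 in the bound of the sort is absorbed by [d * N >= 1]. *)
  apply: le_trans tsort _; apply: C0le; first by rewrite addr_ge0.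
  by rewrite lerD2l -natrM ler1n.
- have cells : (2 + N + d + N * d <= 4 * (d * N))%N by nia.
  have NdN : (N <= d * N)%N by nia.
  move: space; rewrite -(ler_nat R) => /le_trans; apply.
  rewrite natrD mulrDl; apply: lerD.
    by rewrite -!natrM ler_nat.
  by apply: le_trans ssort _; apply: C0le => //; rewrite -natrM ler_nat.
Qed.
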